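(* Let $n\ge2$, let $\boldsymbol{\alpha}\in\mathbb{R}^n$ be completely irrational, and let $\gamma$ be a real number with $$\gamma>n+\frac{\hat{\omega}(\boldsymbol{\alpha})}{\hat{\lambda}(\boldsymbol{\alpha})}.$$ Let $f:\mathbb{R}^n\to\mathbb{R}$ be given by the Fourier series $$f(\boldsymbol{x})=\sum_{\boldsymbol{m}\in\mathbb{Z}^n\setminus\{\boldsymbol{0}\}} f_{\boldsymbol{m}}\exp(2\pi i\,\boldsymbol{m}.\boldsymbol{x})$$ whose coefficients satisfy, for some constant $C>0$, $$|f_{\boldsymbol{m}}|\le C\Bigl(\max_{1\le j\le n}|m_j|\Bigr)^{-\gamma}\qquad\text{for all }\boldsymbol{m}\in\mathbb{Z}^n\setminus\{\boldsymbol{0}\}$$ (in particular, this means that $f$ is $w$-smooth for any $w<\gamma-n$). Then $$\liminf_{t\to\infty}\ \sup_{\boldsymbol{x}\in\mathbb{T}^n}\bigl|S_f^t(\boldsymbol{\alpha},\boldsymbol{x})\bigr|=0 .$$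
   Context: A vector $\boldsymbol{\alpha}=(\alpha_1,\dots,\alpha_n)\in\mathbb{R}^n$ is completely irrational if $1,\alpha_1,\dots,\alpha_n$ are linearly independent over $\mathbb{Q}$. Notation: $\boldsymbol{m}.\boldsymbol{x}=m_1x_1+\dots+m_nx_n$; $\|y\|=\min_{a\in\mathbb{Z}}|y-a|$ for $y\in\mathbb{R}$; $\mathbb{T}^n=\mathbb{R}^n/\mathbb{Z}^n$; for a positive integer $t$, $S_f^t(\boldsymbol{\alpha},\boldsymbol{x})=\sum_{k=0}^{t-1}f(k\boldsymbol{\alpha}+\boldsymbol{x})$, and the $\liminf$ is over positive integers $t$. Put $$\psi_{\boldsymbol{\alpha}}(t)=\min_{\boldsymbol{m}\in\mathbb{Z}^n:\,0<\max_j|m_j|\le t}\|\boldsymbol{\alpha}.\boldsymbol{m}\|,\qquad \psi^*_{\boldsymbol{\alpha}}(t)=\min_{q\in\mathbb{Z},\ 1\le q\le t}\ \max_{1\le j\le n}\|q\alpha_j\|\qquad(t\ge1).$$ The uniform Diophantine exponent (for linear forms) is $$\hat{\omega}(\boldsymbol{\alpha})=\sup\{\gamma\in\mathbb{R}:\ \limsup_{t\to\infty}t^\gamma\psi_{\boldsymbol{\alpha}}(t)<\infty\},$$ and the uniform Diophantine exponent for simultaneous approximation is $$\hat{\lambda}(\boldsymbol{\alpha})=\sup\{\gamma\in\mathbb{R}:\ \limsup_{t\to\infty}t^\gamma\psi^*_{\boldsymbol{\alpha}}(t)<\infty\}.$$ For a non-negative integer $w$, a function $g:\mathbb{R}^n\to\mathbb{R}$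 is called $w$-smooth if all its partial derivatives $\partial^{w}g/(\partial^{w_1}x_1\cdots\partial^{w_n}x_n)$ with $0\le w_1,\dots,w_n\le w$, $w_1+\dots+w_n=w$, are continuous on $\mathbb{R}^n$. *)

(* Defs.v *)
From HB Require Import structures.
From mathcomp Require Import all_boot all_order all_algebra.
From mathcomp Require Import finmap complex.
From mathcomp Require Import all_classical all_reals all_analysis summability.

Set Implicit Arguments.
Unset Strict Implicit.
Unset Printing Implicit Defensive.

Import Order.TTheory GRing.Theory Num.Theory.
Import numFieldNormedType.Exports.

Local Open Scope classical_set_scope.
Local Open Scope ring_scope.

Section Diophantine.
Context {R : realType} {n : nat}.
Implicit Types (m : 'rV[int]_n) (alpha x : 'rV[R]_n).

Definition dotz m x : R := \sum_(j < n) (m 0 j)%:~R * x 0 j.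

Definition maxabs m : nat := \max_(j < n) `|m 0%R j|%N.

Definition completely_irrational alpha : Prop :=
  forall (q0 : rat) (q : 'rV[rat]_n),
    ratr q0 * 1 + \sum_(j < n) ratr (q 0 j) * alpha 0 j = 0 ->
    q0 = 0 /\ q = 0.

(* In [dist_int], [psi] and [psi_star] the infimum is attained: the set of
   values is nonempty (for 1 <= t and 0 < n), bounded below, and it is finite
   or, in the case of [dist_int], discrete. *)
Definition dist_int (y : R) : R := inf [set `|y - a%:~R| | a in [set: int]].

Definition psi alpha (t : R) : R :=
  inf [set dist_int (dotz m alpha) |
        m in [set m | (0 < maxabs m)%N /\ (maxabs m)%:R <= t]].

Definition psi_star alpha (t : R) : R :=
  inf [set \big[Num.max/0]_(j < n) dist_int (q%:~R * alpha 0 j) |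
        q in [set q : int | 1 <= q /\ q%:~R <= t]].

(* Both exponents are extended reals since [omega_hat alpha] may be [+oo]. *)
Definition omega_hat alpha : \bar R :=
  ereal_sup [set g%:E | g in
    [set g : R |
      (limf_esup (fun t : R => (t `^ g * psi alpha t)%:E) (pinfty_nbhs R)
         < +oo)%E]].

Definition lambda_hat alpha : \bar R :=
  ereal_sup [set g%:E | g in
    [set g : R |
      (limf_esup (fun t : R => (t `^ g * psi_star alpha t)%:E) (pinfty_nbhs R)
         < +oo)%E]].

End Diophantine.

Section FourierSeries.
Context {R : realType} {n : nat}.

Definition expi (theta : R) : R[i] := (cos theta +i* sin theta)%C.

(* Pointwise unconditional convergence: limit of the partial sums along the
   finite sets of nonzero frequencies, ordered by inclusion.  The value
   [c 0] is not used. *)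
Definition is_fourier_series (c : 'rV[int]_n -> R[i]) (f : 'rV[R]_n -> R) : Prop :=
  forall x : 'rV[R]_n,
    (fun A : {fset 'rV[int]_n} =>
       \sum_(m <- A | m != 0) c m * expi (2 * pi * dotz m x) : R[i]^o) @ totally
      --> ((f x)%:C%C : R[i]^o).

End FourierSeries.

Section Smoothness.
Context {R : realType} {n : nat}.

(* [partial [:: j1; ...; jk] g] is d/dx_j1 (d/dx_j2 (... (d/dx_jk g))). *)
Fixpoint partial (s : seq 'I_n) (g : 'rV[R]_n -> R) : 'rV[R]_n -> R :=
  if s is j :: s' then fun x => 'D_(delta_mx 0 j) (partial s' g) x else g.

(* ['D_v] is total, so the existence of all the successive derivatives is a
   separate condition. *)
Fixpoint has_partial (s : seq 'I_n) (g : 'rV[R]_n -> R) : Prop :=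
  if s is j :: s' then
    has_partial s' g /\
    forall x : 'rV[R]_n, derivable (partial s' g) x (delta_mx 0 j)
  else True.

(* The differentiations dx_1^(k 1) ... dx_n^(k n), in this order. *)
Definition multi_index_seq (k : 'I_n -> nat) : seq 'I_n :=
  flatten [seq nseq (k j) j | j <- enum 'I_n].

Definition smooth (w : nat) (g : 'rV[R]_n -> R) : Prop :=
  forall k : 'I_n -> nat, (\sum_(j < n) k j)%N = w ->
    has_partial (multi_index_seq k) g /\
    continuous (partial (multi_index_seq k) g).

End Smoothness.

Section BirkhoffSums.
Context {R : realType} {n : nat}.

Definition birkhoff_sum (f : 'rV[R]_n -> R) (t : nat) (alpha x : 'rV[R]_n) : R :=
  \sum_(0 <= k < t) f (k%:R *: alpha + x).

(* For a Z^n-periodic [f], the values of |S| on the torus R^n/Z^n are exactly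
   its values at the representatives [x : 'rV[R]_n]. *)
Definition sup_birkhoff (f : 'rV[R]_n -> R) (t : nat) (alpha : 'rV[R]_n) : \bar R :=
  ereal_sup [set (`|birkhoff_sum f t alpha x|)%:E | x in [set: 'rV[R]_n]].

End BirkhoffSums.

(* Main.v *)
Require Import Defs.
From HB Require Import structures.
From mathcomp Require Import all_boot all_order all_algebra.
From mathcomp Require Import finmap complex.
From mathcomp Require Import all_classical all_reals all_analysis summability.
From mathcomp Require Import ring lra zify.
Set Implicit Arguments.
Unset Strict Implicit.
Unset Printing Implicit Defensive.
Import Order.TTheory GRing.Theory Num.Theory.
Import numFieldNormedType.Exports.
Local Open Scope classical_set_scope.
Local Open Scope ring_scope.

(** Write [Psi] for the function [psi alpha], [w] and [l] for the exponents
    [omega_hat alpha] and [lambda_hat alpha], and [||y||] for [dist_int y].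

    The sum of [exp (2 i pi m.(k alpha + x))] over [0 <= k < t] is at most [t]
    in modulus, and also at most [4 ||t m.alpha|| / ||m.alpha||]
    ([trig_sum_progression_le]).  If every [||t alpha_j||] is at most [d], then
    [||t m.alpha|| <= n |m| d].  Using the second bound for [|m| <= M] and the
    first one for [|m| > M], the Birkhoff sum of length [t] is, uniformly in
    [x], [O(d / Psi M + t M ^ - v)] for every [v < gamma - n]
    ([birkhoff_sum_le]); the low frequencies need the sum of
    [|m| ^ (1 - gamma)] to be finite, that is, [gamma > n + 1].

    For [g > w] there are arbitrarily large [M] with [Psi M >= M ^ - g], by
    definition of the uniform exponent [w].  For [l' < l] every large [Q] admits
    some [t <= Q] with [d = O(Q ^ - l')].  With [Q = M ^ h] the bound becomes
    [O(M ^ (g - l' h) + M ^ (h - v))], which tends to [0] as soon as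
    [g / l' < h < v]; such [h] and [v] exist because [w / l < gamma - n]
    ([small_birkhoff_sums]).  The lengths [t] obtained tend to infinity because
    [alpha] is irrational ([dist_int_lower_bound]).

    Finally [w >= 1] by Dirichlet's theorem applied to one coordinate
    ([omega_hat_ge1]), and [l <= 1] because a larger exponent would make a
    coordinate of [alpha] rational ([lambda_hat_le1]).  Hence [w / l >= 1] and
    [gamma > n + 1]; the hypothesis on [gamma] also excludes [l = 0] and an
    infinite [w] ([exponents_fin]).

    For the smoothness, the series is differentiated term by term: each
    derivative costs one power of [|m|] in the decay of the coefficients, and
    Hoelder estimates interpolated between the trivial and the Lipschitz bounds
    make the error of the difference quotients [O(h ^ t)] uniformly over the
    partial sums, for a small [t > 0] ([trig_series_derive], [trig_series_continuous]).  All these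
    arguments use finite sums over frequencies only, through the bound
    [sum_maxabs_bounded] on the sums of [|m| ^ - s] for [s > n]. *)

#[local] Existing Instance totally_filter.

(** * Lattice sums *)

Section LatticeSums.
Context {R : realType}.

(** Dyadic blocks: the terms with [2 ^ i <= k < 2 ^ i.+1] contribute at most
    the [i]-th term of a convergent geometric series. *)
Lemma sum_powR_bounded (s : R) : 1 < s ->
  exists2 K : R, 0 <= K &
    forall N : nat, \sum_(1 <= k < N) k%:R `^ (- s) <= K.
Proof.
move=> s1.
pose r : R := 2 `^ (1 - s).
have r0 : 0 < r by rewrite powR_gt0.
have r1 : r < 1.
  rewrite /r -[ltRHS](powRr0 2) /powR pnatr_eq0/=.
  by rewrite ltr_expR ltr_pM2r ?ln_gt0 ?ltr1n// subr_lt0.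
have blk L : \sum_(1 <= k < 2 ^ L) k%:R `^ (- s) <= \sum_(0 <= i < L) r ^+ i.
  elim: L => [|L IH]; first by rewrite !big_geq.
  rewrite big_nat_recr//= (@big_cat_nat _ _ _ (2 ^ L))//=; last 2 first.
  - by rewrite expn_gt0.
  - by rewrite leq_exp2l.
  apply: lerD => //.
  have -> : r ^+ L = \sum_(2 ^ L <= k < 2 ^ L.+1) (2 ^ L)%:R `^ (- s).
    rewrite big_const_nat iter_addr_0 expnS mul2n -addnn addnK -[RHS]mulr_natr.
    rewrite natrX -[LHS]powR_mulrn ?powR_ge0// /r.
    rewrite -powRrM -powR_mulrn// -powRrM.
    by rewrite -powRD; [congr (_ `^ _); ring|rewrite pnatr_eq0 implybT].
  rewrite big_nat_cond [leRHS]big_nat_cond; apply: ler_sum => k /andP[/andP[k1 k2] _].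
  rewrite !powRN lef_pV2 ?posrE ?powR_gt0 ?ltr0n ?expn_gt0//; last first.
    by rewrite (leq_trans _ k1)// expn_gt0.
  by apply: ge0_ler_powR; rewrite ?nnegrE ?ler0n ?ler_nat//; lra.
exists (1 - r)^-1; first by rewrite invr_ge0; lra.
move=> N; apply: le_trans (_ : _ <= \sum_(0 <= i < N) r ^+ i) _.
  apply: le_trans (blk N).
  case: N => [|N]; first by rewrite big_geq.
  rewrite (@big_cat_nat _ _ _ N.+1 1 (2 ^ N.+1))//=; last by rewrite ltnW// ltn_expl.
  by rewrite lerDl sumr_ge0// => i _; rewrite powR_ge0.
have r1' : 1 - r != 0 by rewrite subr_eq0 gt_eqF.
have := @subrX1 R r N; rewrite -(big_mkord xpredT (fun i => r ^+ i)) => E.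
rewrite -(ler_pM2l (_ : 0 < 1 - r)) ?subr_gt0// divff//.
have -> : (1 - r) * \sum_(0 <= i < N) r ^+ i = 1 - r ^+ N by lra.
by rewrite gerBl exprn_ge0// ltW.
Qed.

Lemma maxabs_gt0 n (m : 'rV[int]_n) : m != 0 -> (0 < maxabs m)%N.
Proof.
apply: contraNT; rewrite -eqn0Ngt => /eqP m0; apply/eqP/rowP => j.
have : (`|m 0%R j| <= maxabs m)%N by rewrite /maxabs (leq_bigmax j).
by rewrite m0 leqn0 absz_eq0 mxE => /eqP.
Qed.

Lemma le_maxabs n (m : 'rV[int]_n) j : (`|m 0%R j| <= maxabs m)%N.
Proof. by rewrite /maxabs (leq_bigmax j). Qed.

(** Transfer of a sum of nonnegative terms along an injection into a finite
    type. *)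
Lemma ler_sum_inj (I : eqType) (J : finType) (A : seq I) (P : pred I)
    (phi : I -> J) (G : J -> R) :
  uniq A -> {in A &, injective phi} -> (forall j, 0 <= G j) ->
  \sum_(i <- A | P i) G (phi i) <= \sum_(j : J) G j.
Proof.
move=> uA iphi G0; rewrite -big_filter.
rewrite -(big_map phi xpredT G) big_uniq/=; last first.
  rewrite map_inj_in_uniq ?filter_uniq// => x y.
  by rewrite !mem_filter => /andP[_ xA] /andP[_ yA]; exact: iphi.
rewrite big_mkcond/=; apply: ler_sum => j _.
by case: ifP.
Qed.

(** Since [max 1 |m_j| <= |m|] for every [j], the term [|m| ^ - s] is at most
    the product over [j] of [(max 1 |m_j|) ^ - (s / n)]: the sum over a box is
    bounded by the [n]-th power of a one-dimensional sum. *)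
Lemma sum_maxabs_bounded n (s : R) : (0 < n)%N -> n%:R < s ->
  exists2 K : R, 0 <= K & forall A : {fset 'rV[int]_n},
    \sum_(m <- A | m != 0) (maxabs m)%:R `^ (- s) <= K.
Proof.
move=> n0 ns.
have n0' : 0 < n%:R :> R by rewrite ltr0n.
pose u := s / n%:R.
have u1 : 1 < u by rewrite /u ltr_pdivlMr ?mul1r.
have [K K0 HK] := sum_powR_bounded u1.
exists ((2 * (1 + K)) ^+ n); first by rewrite exprn_ge0//; lra.
move=> A.
pose N := (\max_(m <- A) maxabs m)%N.
have AN m : m \in A -> (maxabs m <= N)%N.
  by move=> mA; rewrite /N (big_rem m)//= leq_maxl.
pose J : finType := {ffun 'I_n -> bool * 'I_N.+1}.
(* a frequency is encoded by the signs and absolute values of its entries *)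
pose phi (m : 'rV[int]_n) : J :=
  [ffun j => (0 <= m 0 j, inord `|m 0%R j|%N)].
pose w (k : nat) : R := (maxn 1 k)%:R `^ (- u).
pose G (g : J) : R := \prod_j w (g j).2.
have w0 k : 0 <= w k by rewrite powR_ge0.
have G0 g : 0 <= G g by apply: prodr_ge0 => j _.
have iphi : {in A &, injective phi}.
  move=> a b aA bA /ffunP ab; apply/rowP => j; move: (ab j).
  rewrite !ffunE => -[sg /(congr1 val)].
  rewrite /= !inordK ?ltnS; last 2 first.
  - exact: leq_trans (le_maxabs b j) (AN _ bA).
  - exact: leq_trans (le_maxabs a j) (AN _ aA).
  by move: sg; case: (a 0 j) => x; case: (b 0 j) => y //=; lia.
apply: le_trans (_ : \sum_(m <- A | m != 0) G (phi m) <= _).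
  rewrite [leLHS]big_seq_cond [leRHS]big_seq_cond.
  apply: ler_sum => m /andP[mA m0].
  have M0 := maxabs_gt0 m0.
  have -> : (maxabs m)%:R `^ (- s) = \prod_(j < n) (maxabs m)%:R `^ (- u) :> R.
    rewrite prodr_const card_ord -powR_mulrn ?powR_ge0// -powRrM /u.
    by congr (_ `^ _); field; rewrite gt_eqF.
  apply: ler_prod => j _; rewrite powR_ge0/= /w ffunE/= inordK; last first.
    by rewrite ltnS (leq_trans (le_maxabs m j))// AN.
  rewrite !powRN lef_pV2 ?posrE ?powR_gt0 ?ltr0n ?leq_max//.
  apply: ge0_ler_powR; rewrite ?nnegrE ?ler0n ?ler_nat ?geq_max ?le_maxabs ?M0//.
  lra.
apply: le_trans (ler_sum_inj _ _ iphi G0) _ => //.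
rewrite /G -(bigA_distr_bigA (fun (_ : 'I_n) (p : bool * 'I_N.+1) => w p.2))/= prodr_const card_ord.
rewrite lerXn2r ?nnegrE ?sumr_ge0//; first by lra.
rewrite -(pair_bigA _ (fun (_ : bool) (k : 'I_N.+1) => w k))/= sumr_const card_bool.
rewrite -[leLHS]mulr_natl ler_pM2l//.
rewrite -(big_mkord xpredT) big_nat_recl//= /w maxn0 powR1 lerD2l.
apply: le_trans (HK N.+1).
by rewrite big_add1/=; apply: ler_sum => i _; rewrite maxnC (maxn_idPl _).
Qed.

End LatticeSums.

(** * Hoelder estimates for the trigonometric functions *)

Section TrigEstimates.
Context {R : realType}.
Implicit Types (u v t theta a b : R).

Lemma mean_value_ge0 (f df : R -> R) u : 0 <= u ->
  (forall x : R, is_derive x 1 f (df x)) ->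
  exists2 z, 0 <= z <= u & f u - f 0 = df z * u.
Proof.
move=> u0 fd.
have cf : {within `[0, u], continuous f}.
  apply: continuous_subspaceT => x.
  by apply/differentiable_continuous/derivable1_diffP; case: (fd x).
have [z] := MVT_segment u0 (fun x _ => fd x) cf.
by rewrite in_itv/= subr0 => z0u ->; exists z.
Qed.

(** Interpolation: a quantity bounded both by [2] and by [w] is at most
    [2 * w ^ t] for every exponent [t] between [0] and [1]. *)
Lemma ler_powR_interp v w t : 0 <= t <= 1 -> 0 <= w -> v <= w -> v <= 2 ->
  v <= 2 * w `^ t.
Proof.
move=> /andP[t0 t1] w0 vw v2.
have [w1|w1] := lerP 1 w.
  have : 1 <= w `^ t by rewrite -(powRr0 w) ler_powR.
  by lra.
move: w0; rewrite le_eqVlt => /predU1P[w0|w0].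
  have := powR_ge0 w t; lra.
have : w <= w `^ t by rewrite ger1_powR// w0 ltW.
by have := powR_ge0 w t; lra.
Qed.

Lemma ler_norm_sin u : `|sin u| <= `|u|.
Proof.
wlog u0 : u / 0 <= u => [H|].
  have [|u0] := lerP 0 u; first exact: H.
  by rewrite -[sin u]opprK -sinN normrN -(normrN u); apply: H; lra.
have [z _] := mean_value_ge0 u0 (@is_derive_sin R).
rewrite sin0 subr0 => ->.
by rewrite normrM ler_piMl// cos_max.
Qed.

Lemma ler_norm_cosB1 u : `|cos u - 1| <= `|u|.
Proof.
wlog u0 : u / 0 <= u => [H|].
  have [|u0] := lerP 0 u; first exact: H.
  by rewrite -cosN -(normrN u); apply: H; lra.
have [z _] := mean_value_ge0 u0 (@is_derive_cos R).
rewrite cos0 => ->.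
by rewrite normrM ler_piMl// normrN sin_max.
Qed.

Lemma ler_norm_sin_powR u t : 0 <= t <= 1 -> `|sin u| <= 2 * `|u| `^ t.
Proof.
move=> t01; apply: ler_powR_interp => //; first exact: ler_norm_sin.
by apply: le_trans (sin_max u) _; lra.
Qed.

Lemma ler_norm_cosB1_powR u t : 0 <= t <= 1 -> `|cos u - 1| <= 2 * `|u| `^ t.
Proof.
move=> t01; apply: ler_powR_interp => //; first exact: ler_norm_cosB1.
have := cos_le1 u; have := cos_geN1 u => ? ?.
by rewrite ler_norml; lra.
Qed.

Lemma ler_norm_cosB1_powR1D u t : 0 <= t <= 1 ->
  `|cos u - 1| <= 2 * `|u| `^ (1 + t).
Proof.
move=> t01; wlog u0 : u / 0 <= u => [H|].
  have [|u0] := lerP 0 u; first exact: H.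
  by rewrite -cosN -(normrN u); apply: H; lra.
have [z /andP[z0 zu]] := mean_value_ge0 u0 (@is_derive_cos R).
rewrite cos0 => ->.
rewrite normrM normrN powRD; last by apply/implyP => /eqP; lra.
rewrite powRr1// mulrCA mulrC ler_wpM2l//.
apply: le_trans (ler_norm_sin_powR z t01) _; rewrite ler_pM2l//.
case/andP: t01 => t0 _.
by apply: ge0_ler_powR; rewrite ?nnegrE// !ger0_norm.
Qed.

Lemma ler_norm_sinB_powR1D u t : 0 <= t <= 1 ->
  `|sin u - u| <= 2 * `|u| `^ (1 + t).
Proof.
move=> t01; wlog u0 : u / 0 <= u => [H|].
  have [|u0] := lerP 0 u; first exact: H.
  rewrite -normrN opprB -(normrN u).
  have -> : u - sin u = sin (- u) - (- u) by rewrite sinN; ring.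
  by apply: H; lra.
have dsi (x : R) : is_derive x 1 (fun y : R => sin y - y) (cos x - 1).
  exact: (@is_deriveB _ _ _ sin id x 1 (cos x) 1).
have [z /andP[z0 zu]] := mean_value_ge0 u0 dsi.
rewrite sin0 !subr0 => ->.
rewrite normrM powRD; last by apply/implyP => /eqP; lra.
rewrite powRr1// mulrCA mulrC ler_wpM2l//.
apply: le_trans (ler_norm_cosB1_powR z t01) _; rewrite ler_pM2l//.
case/andP: t01 => t0 _.
by apply: ge0_ler_powR; rewrite ?nnegrE// !ger0_norm.
Qed.

(** The real part of [(a + i b) * exp (i theta)]. *)
Definition trig a b theta : R := a * cos theta - b * sin theta.

Lemma ler_norm_trig a b theta : `|trig a b theta| <= `|a| + `|b|.
Proof.
apply: le_trans (ler_normB _ _) _; rewrite !normrM.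
by apply: lerD; apply: ler_piMr; rewrite ?cos_max ?sin_max.
Qed.

Lemma trigD_sub a b theta u : trig a b (theta + u) - trig a b theta =
  trig a b theta * (cos u - 1) + trig (- b) a theta * sin u.
Proof. by rewrite /trig cosD sinD; ring. Qed.

Lemma trig_holder a b theta u t : 0 <= t <= 1 ->
  `|trig a b (theta + u) - trig a b theta| <= 4 * (`|a| + `|b|) * `|u| `^ t.
Proof.
move=> t01; rewrite trigD_sub; apply: le_trans (ler_normD _ _) _.
have -> : 4 * (`|a| + `|b|) * `|u| `^ t =
  (`|a| + `|b|) * (2 * `|u| `^ t) + (`|a| + `|b|) * (2 * `|u| `^ t) by ring.
rewrite !normrM; apply: lerD; apply: ler_pM => //.
- exact: ler_norm_trig.
- exact: ler_norm_cosB1_powR.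
- by rewrite addrC -(normrN b) ler_norm_trig.
- exact: ler_norm_sin_powR.
Qed.

Lemma trig_taylor a b theta u t : 0 <= t <= 1 ->
  `|trig a b (theta + u) - trig a b theta - u * trig (- b) a theta|
    <= 4 * (`|a| + `|b|) * `|u| `^ (1 + t).
Proof.
move=> t01; rewrite trigD_sub -addrA [u * _]mulrC -mulrBr.
apply: le_trans (ler_normD _ _) _.
have -> : 4 * (`|a| + `|b|) * `|u| `^ (1 + t) =
  (`|a| + `|b|) * (2 * `|u| `^ (1 + t)) +
  (`|a| + `|b|) * (2 * `|u| `^ (1 + t)) by ring.
rewrite !normrM; apply: lerD; apply: ler_pM => //.
- exact: ler_norm_trig.
- exact: ler_norm_cosB1_powR1D.
- by rewrite addrC -(normrN b) ler_norm_trig.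
- exact: ler_norm_sinB_powR1D.
Qed.

End TrigEstimates.

(** * Unconditional trigonometric series *)


Section Totally.
Context {R : realType} {I : choiceType}.
Implicit Types (u v : I -> R) (S : {fset I} -> R) (P : pred I).

Lemma ler_sum_fsubset u P (A B : {fset I}) : (forall i, 0 <= u i) ->
  (A `<=` B)%fset -> \sum_(i <- A | P i) u i <= \sum_(i <- B | P i) u i.
Proof.
move=> u0 AB; rewrite [leRHS](big_fsetIDcond _ (mem A))/=.
have -> : [fset x in B | x \in A]%fset = A.
  apply/fsetP => i; rewrite !inE /=; apply/andP/idP => [[]//|iA].
  by split=> //; exact: (fsubsetP AB).
by rewrite lerDl sumr_ge0.
Qed.

Lemma totally_cvg_ge0 u P (K : R) : (forall i, 0 <= u i) ->
  (forall A : {fset I}, \sum_(i <- A | P i) u i <= K) ->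
  exists l : R, (fun A : {fset I} => \sum_(i <- A | P i) u i) @ totally --> l.
Proof.
move=> u0 uK; pose S (A : {fset I}) : R := \sum_(i <- A | P i) u i.
pose E := range S.
have Esup : has_sup E.
  split; first by exists (S fset0); exists fset0.
  by exists K => _ [A _ <-]; exact: uK.
exists (sup E); apply/cvgrPdist_lt => e e0.
have [_ [A0 _ <-] A0e] := sup_adherent e0 Esup.
exists A0 => // B /= A0B.
have BE : S B <= sup E by apply: ub_le_sup; [case: Esup|exists B].
have : S A0 <= S B by exact: ler_sum_fsubset.
rewrite -/(S B) ger0_norm ?subr_ge0//; lra.
Qed.

(** Absolutely bounded families are unconditionally summable. *)
Lemma totally_cvg_abs u P (K : R) :
  (forall A : {fset I}, \sum_(i <- A | P i) `|u i| <= K) ->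
  exists l : R, (fun A : {fset I} => \sum_(i <- A | P i) u i) @ totally --> l.
Proof.
move=> uK.
(* [u] is the difference of the nonnegative families [|u| + u] and [|u|] *)
have [||l1 cv1] := @totally_cvg_ge0 (fun i => `|u i| + u i) P (K + K).
- by move=> i; have := ler_norm (- u i); rewrite normrN; lra.
- move=> A; rewrite big_split/=; apply: lerD (uK A) _.
  by apply: le_trans (uK A); apply: ler_sum => i _; exact: ler_norm.
have [|l2 cv2] := totally_cvg_ge0 _ uK; first by [].
exists (l1 - l2).
rewrite (_ : (fun A : {fset I} => _) = fun A =>
  \sum_(i <- A | P i) (`|u i| + u i) - \sum_(i <- A | P i) `|u i|).
  exact: cvgB cv1 cv2.
apply/funext => A; rewrite -sumrB.
by apply: eq_bigr => i _; rewrite addrAC subrr add0r.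
Qed.

Lemma totally_lim_le S (l K : R) : (forall A, `|S A| <= K) ->
  S @ totally --> l -> `|l| <= K.
Proof.
move=> SK cvS; apply/ler_addgt0Pr => e e0.
have /filter_ex[A SA] : \forall A \near totally, `|l - S A| < e.
  by move/cvgrPdist_lt : cvS; exact.
have := SK A; have -> : l = (l - S A) + S A by rewrite subrK.
have := ler_normD (l - S A) (S A); lra.
Qed.

End Totally.

Section TrigSeries.
Context {R : realType} {n : nat}.
Context (n0 : (0 < n)%N).
Implicit Types (m : 'rV[int]_n) (x y : 'rV[R]_n) (a b : 'rV[int]_n -> R).

Lemma dotzD m x y : dotz m (x + y) = dotz m x + dotz m y.
Proof.
by rewrite /dotz -big_split/=; apply: eq_bigr => j _; rewrite mxE mulrDr.
Qed.

Lemma dotzZ m (h : R) x : dotz m (h *: x) = h * dotz m x.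
Proof.
by rewrite /dotz mulr_sumr; apply: eq_bigr => j _; rewrite mxE mulrCA.
Qed.

Lemma dotz_delta m j : dotz m (delta_mx 0 j) = (m 0 j)%:~R :> R.
Proof.
rewrite /dotz (bigD1 j)//= mxE !eqxx mulr1 big1 ?addr0// => i ij.
by rewrite mxE (negPf ij) andbF mulr0.
Qed.

Lemma ler_norm_coord m j : `|(m 0 j)%:~R| <= (maxabs m)%:R :> R.
Proof. by rewrite -intr_norm -abszE -pmulrn ler_nat le_maxabs. Qed.

Lemma ler_norm_entry x j : `|x 0 j| <= `|x|.
Proof.
by rewrite [leRHS]/Num.norm /= mx_normrE; apply/bigmax_geP; right; exists (0, j).
Qed.

Lemma ler_norm_dotz m x : `|dotz m x| <= n%:R * `|x| * (maxabs m)%:R.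
Proof.
apply: le_trans (ler_norm_sum _ _ _) _.
apply: le_trans (_ : _ <= \sum_(j < n) (maxabs m)%:R * `|x|) _.
  apply: ler_sum => j _; rewrite normrM; apply: ler_pM => //.
    exact: ler_norm_coord.
  exact: ler_norm_entry.
by rewrite sumr_const card_ord -[leLHS]mulr_natl mulrA mulrAC.
Qed.

(** Coefficients that are [O(|m| ^ - s)]. *)
Definition decay (s : R) a : Prop := exists2 D : R, 0 <= D &
  forall m, m != 0 -> `|a m| <= D * (maxabs m)%:R `^ (- s).

(** The partial sum over the nonzero frequencies of [A]; its terms are the
    real parts of [(a m + i b m) * exp (2 i pi m.x)]. *)
Definition trig_sum a b x (A : {fset 'rV[int]_n}) : R :=
  \sum_(m <- A | m != 0) trig (a m) (b m) (2 * pi * dotz m x).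

Definition is_trig_series a b (g : 'rV[R]_n -> R) : Prop :=
  forall x, trig_sum a b x @ totally --> g x.

Lemma decay_sum s t a : n%:R + t < s -> decay s a ->
  exists2 K : R, 0 <= K & forall A : {fset 'rV[int]_n},
    \sum_(m <- A | m != 0) `|a m| * (maxabs m)%:R `^ t <= K.
Proof.
move=> nts [D D0 aD].
have nst : n%:R < s - t by lra.
have [K K0 HK] := sum_maxabs_bounded n0 nst.
exists (D * K); first exact: mulr_ge0.
move=> A; apply: le_trans (_ : _ <= D * \sum_(m <- A | m != 0)
    (maxabs m)%:R `^ (- (s - t))) _; last by rewrite ler_wpM2l.
rewrite mulr_sumr; apply: ler_sum => m m0.
have M0 : (maxabs m)%:R != 0 :> R by rewrite pnatr_eq0 -lt0n maxabs_gt0.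
rewrite opprB addrC powRD; last by rewrite M0 implybT.
by rewrite mulrA ler_wpM2r ?powR_ge0// aD.
Qed.

(** Partial sums whose terms are at most
    [4 (|a m| + |b m|) (r |m|) ^ t] are [O(r ^ t)], uniformly in the set of
    frequencies; this covers both the Hoelder and the Taylor estimates. *)
Lemma trig_sum_le s t a b :
  n%:R + t < s -> decay s a -> decay s b ->
  exists2 K : R, 0 <= K & forall (F : 'rV[int]_n -> R) (r : R), 0 <= r ->
    (forall m, m != 0 ->
       `|F m| <= 4 * (`|a m| + `|b m|) * (r * (maxabs m)%:R) `^ t) ->
    forall A : {fset 'rV[int]_n},
      `|\sum_(m <- A | m != 0) F m| <= K * r `^ t.
Proof.
move=> nts da db.
have [K1 K10 HK1] := decay_sum nts da.
have [K2 K20 HK2] := decay_sum nts db.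
exists (4 * (K1 + K2)); first by lra.
move=> F r r0 HF A; apply: le_trans (ler_norm_sum _ _ _) _.
apply: le_trans (_ : _ <= \sum_(m <- A | m != 0)
   4 * r `^ t * (`|a m| * (maxabs m)%:R `^ t + `|b m| * (maxabs m)%:R `^ t)) _.
  apply: ler_sum => m m0; apply: le_trans (HF m m0) _.
  by rewrite powRM//; lra.
rewrite -mulr_sumr big_split/= mulrAC ler_wpM2r ?powR_ge0//.
by rewrite ler_pM2l//; apply: lerD.
Qed.

End TrigSeries.

Section TrigSeriesRegularity.
Context {R : realType} {n : nat}.
Implicit Types (m : 'rV[int]_n) (x y : 'rV[R]_n) (a b : 'rV[int]_n -> R).

Lemma powR_lim0 (K t e : R) : 0 <= K -> 0 < t -> 0 < e ->
  exists2 d : R, 0 < d & forall r, 0 <= r < d -> K * r `^ t < e.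
Proof.
move=> K0 t0 e0; pose w := (e / (K + 1)) `^ (t^-1).
have K1 : 0 < K + 1 by lra.
exists w; first by rewrite powR_gt0// divr_gt0.
move=> r /andP[r0 rw].
have rt : r `^ t < e / (K + 1).
  have -> : e / (K + 1) = w `^ t.
    by rewrite -powRrM mulVf ?gt_eqF// powRr1// divr_ge0// ltW.
  by rewrite gt0_ltr_powR ?nnegrE// powR_ge0.
rewrite ltr_pdivlMr// in rt.
have := powR_ge0 r t; nra.
Qed.

(** [diff_re j b m] and [diff_im j a m] are the real and imaginary parts of
    [2 i pi m_j (a m + i b m)], the coefficient of the derivative in the
    direction [j]. *)
Definition diff_re (j : 'I_n) b m : R := - (2 * pi * (m 0 j)%:~R * b m).
Definition diff_im (j : 'I_n) a m : R := 2 * pi * (m 0 j)%:~R * a m.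

Lemma decay_diff_im (s : R) a (j : 'I_n) : decay s a ->
  decay (s - 1) (diff_im j a).
Proof.
move=> [D D0 aD]; have pi0 := pi_ge0 R; exists (2 * pi * D).
  by rewrite !mulr_ge0.
move=> m m0; rewrite /diff_im normrM normrM (ger0_norm (mulr_ge0 _ _))//.
rewrite -!mulrA ler_pM2l// ler_wpM2l//.
have M0 : (maxabs m)%:R != 0 :> R by rewrite pnatr_eq0 -lt0n maxabs_gt0.
rewrite opprB addrC powRD; last by rewrite M0 implybT.
rewrite powRr1// mulrA mulrC; apply: ler_pM => //; first exact: aD.
exact: ler_norm_coord.
Qed.

Lemma decayN (s : R) a : decay s a -> decay s (fun m => - a m).
Proof. by move=> [D D0 aD]; exists D => // m m0; rewrite normrN aD. Qed.

Lemma trig_series_cvg (s : R) a b : (0 < n)%N -> n%:R < s ->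
  decay s a -> decay s b -> exists g, is_trig_series a b g.
Proof.
move=> n0 ns da db.
have ns0 : n%:R + 0 < s by rewrite addr0.
have [K1 K10 HK1] := decay_sum n0 ns0 da.
have [K2 K20 HK2] := decay_sum n0 ns0 db.
suff H x : exists l : R, trig_sum a b x @ totally --> l.
  by exists (fun x => sval (cid (H x))) => x; exact: svalP (cid (H x)).
apply: (@totally_cvg_abs _ _ _ _ (K1 + K2)) => A.
apply: le_trans (lerD (HK1 A) (HK2 A)); rewrite -big_split/=.
by apply: ler_sum => m _; rewrite powRr0 !mulr1 ler_norm_trig.
Qed.

Lemma trig_series_continuous (s : R) a b g : (0 < n)%N -> n%:R < s ->
  decay s a -> decay s b -> is_trig_series a b g -> continuous g.
Proof.
move=> n0 ns da db ser.
have [t t01 nts] : exists2 t : R, 0 < t <= 1 & n%:R + t < s.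
  exists (Num.min 1 ((s - n%:R) / 2)).
    by rewrite lt_min ge_min lexx ltr01/= divr_gt0 ?andbT// subr_gt0.
  have : Num.min 1 ((s - n%:R) / 2) <= (s - n%:R) / 2 by rewrite ge_min lexx orbT.
  lra.
have [K K0 HK] := trig_sum_le n0 nts da db.
have pi0 := pi_ge0 R.
have gK x y : `|g x - g y| <= K * (2 * pi * (n%:R * `|x - y|)) `^ t.
  apply: (@totally_lim_le _ _ (fun A => trig_sum a b x A - trig_sum a b y A)).
    move=> A; rewrite /trig_sum -sumrB; apply: HK.
      by rewrite !mulr_ge0.
    move=> m m0.
    have -> : 2 * pi * dotz m x = 2 * pi * dotz m y + 2 * pi * dotz m (x - y).
      by rewrite -mulrDr -dotzD addrC subrK.
    apply: le_trans (trig_holder _ _ _ _ (_ : 0 <= t <= 1)) _; first by lra.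
    rewrite ler_wpM2l//.
    apply: ge0_ler_powR; rewrite ?nnegrE ?mulr_ge0//; first by lra.
    rewrite normrM (ger0_norm (mulr_ge0 _ _))// -[leRHS]mulrA.
    rewrite ler_wpM2l ?mulr_ge0//.
    exact: ler_norm_dotz.
  exact: cvgB (ser x) (ser y).
move=> x; apply/(@cvgrPdist_lt _ R^o _ (nbhs x) (nbhs_filter x) g) => e e0.
have [d d0 Hd] := powR_lim0 K0 (proj1 (andP t01)) e0.
have c0 : 0 < 2 * pi * n%:R :> R by rewrite !mulr_gt0 ?pi_gt0 ?ltr0n.
near=> y.
apply: le_lt_trans (gK x y) _; apply: Hd.
rewrite !mulr_ge0//= mulrA mulrC -ltr_pdivlMr//.
near: y; apply: (@cvgr_dist_lt _ _ _ (nbhs x) _ id x) => //.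
by rewrite divr_gt0.
Unshelve. all: by end_near. Qed.

(** Termwise differentiation: the error of the first-order expansion of each
    partial sum is [O(h ^ (1 + t))], uniformly in the partial sum. *)
Lemma trig_series_derive (s : R) a b g j : (0 < n)%N -> n%:R + 1 < s ->
  decay s a -> decay s b -> is_trig_series a b g ->
  (forall x, derivable g x (delta_mx 0 j)) /\
  is_trig_series (diff_re j b) (diff_im j a)
    (fun x => 'D_(delta_mx 0 j) g x).
Proof.
move=> n0 ns da db ser.
have da' : decay (s - 1) (diff_im j a) by exact: decay_diff_im.
have db' : decay (s - 1) (diff_re j b).
  by apply: decayN; exact: (decay_diff_im j db).
have ns1 : n%:R < s - 1 by lra.
have [G serG] := trig_series_cvg n0 ns1 db' da'.
have [t t01 nts] : exists2 t : R, 0 < t <= 1 & n%:R + (1 + t) < s.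
  exists (Num.min 1 ((s - n%:R - 1) / 2)).
    rewrite lt_min ge_min lexx ltr01/= divr_gt0 ?andbT//; lra.
  have : Num.min 1 ((s - n%:R - 1) / 2) <= (s - n%:R - 1) / 2.
    by rewrite ge_min lexx orbT.
  lra.
have [K K0 HK] := trig_sum_le n0 nts da db.
have pi0 := pi_ge0 R.
have gK x (h : R) : `|g (h *: delta_mx 0 j + x) - g x - h * G x| <=
    K * (2 * pi * `|h|) `^ (1 + t).
  apply: (@totally_lim_le _ _ (fun A => trig_sum a b (h *: delta_mx 0 j + x) A
      - trig_sum a b x A - h * trig_sum (diff_re j b) (diff_im j a) x A)).
    move=> A; rewrite /trig_sum mulr_sumr -!sumrB; apply: HK.
      by rewrite !mulr_ge0.
    move=> m m0.
    rewrite dotzD dotzZ dotz_delta mulrDr.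
    set u := 2 * pi * (h * _); set th := 2 * pi * dotz m x.
    have -> : h * trig (diff_re j b m) (diff_im j a m) th =
        u * trig (- b m) (a m) th.
      by rewrite /trig /diff_re /diff_im /u; ring.
    rewrite (addrC u).
    apply: le_trans (trig_taylor _ _ _ _ (_ : 0 <= t <= 1)) _; first by lra.
    rewrite ler_wpM2l//.
    apply: ge0_ler_powR; rewrite ?nnegrE ?mulr_ge0//; first by lra.
    rewrite /u !normrM (ger0_norm pi0) ger0_norm// -!mulrA !ler_wpM2l//.
    exact: ler_norm_coord.
  apply: cvgB; first exact: cvgB (ser _) (ser _).
  exact: cvgMr (serG x).
have dG x : h^-1 *: (g (h *: delta_mx 0 j + x) - g x) @[h --> 0^'] --> (G x : R).
  apply/cvgrPdist_lt => e e0.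
  have c0 : 0 < 2 * pi :> R by rewrite mulr_gt0 ?pi_gt0.
  have K0' : 0 <= K * (2 * pi) `^ (1 + t) by rewrite mulr_ge0// powR_ge0.
  have [d d0 Hd] := powR_lim0 K0' (proj1 (andP t01)) e0.
  near=> h.
  have h0 : h != 0 by near: h; exact: nbhs_dnbhs_neq.
  have hp : 0 < `|h| by rewrite normr_gt0.
  have -> : G x - h^-1 *: (g (h *: delta_mx 0 j + x) - g x) =
      - h^-1 * (g (h *: delta_mx 0 j + x) - g x - h * G x).
    by rewrite /GRing.scale/=; field.
  rewrite normrM normrN normfV mulrC ltr_pdivrMr//.
  apply: le_lt_trans (gK x h) _.
  rewrite powRM ?(ltW c0)// [X in _ * (_ * X)]powRD; last by rewrite (gt_eqF hp) implybT.
  rewrite powRr1// (mulrC `|h|) !mulrA ltr_pM2r//; apply: Hd.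
  rewrite normr_ge0/=; near: h.
  by apply: dnbhs0_lt.
have DG x : 'D_(delta_mx 0 j) g x = G x by apply: cvg_lim (dG x).
split=> [x|x]; first by apply/cvg_ex; exists (G x); exact: dG.
by rewrite DG; exact: serG.
Unshelve. all: by end_near. Qed.

Lemma trig_series_partial (s : R) a b g (l : seq 'I_n) : (0 < n)%N ->
  n%:R + (size l)%:R < s -> decay s a -> decay s b -> is_trig_series a b g ->
  has_partial l g /\
  exists a' b', [/\ decay (s - (size l)%:R) a', decay (s - (size l)%:R) b' &
    is_trig_series a' b' (partial l g)].
Proof.
move=> n0 + da db ser; elim: l => [|j l IH] /=.
  by rewrite subr0 => _; split=> //; exists a, b.
rewrite -natr1 => ns.
have [|hp [a' [b' [da' db' ser']]]] := IH; first by lra.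
have ns' : n%:R + 1 < s - (size l)%:R by lra.
have [der ser1] := trig_series_derive j n0 ns' da' db' ser'.
split=> //; exists (diff_re j b'), (diff_im j a').
rewrite opprD addrA; split=> //; last exact: decay_diff_im.
by apply: decayN; exact: (decay_diff_im j db').
Qed.

Lemma trig_series_smooth (s : R) a b g (w : nat) : (0 < n)%N ->
  n%:R + w%:R < s -> decay s a -> decay s b -> is_trig_series a b g ->
  smooth w g.
Proof.
move=> n0 ns da db ser k kw.
have sk : size (multi_index_seq k) = w.
  rewrite /multi_index_seq size_flatten /shape -map_comp -kw sumnE big_map.
  by rewrite big_enum/=; apply: eq_bigr => j _; rewrite size_nseq.
have := @trig_series_partial s a b g (multi_index_seq k) n0.
rewrite sk => /(_ ns da db ser)[hp [a' [b' [da' db' ser']]]].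
split=> //; apply: trig_series_continuous da' db' ser' => //; lra.
Qed.

End TrigSeriesRegularity.

(** * Distance to the nearest integer and the Dirichlet kernel *)

Section DistInt.
Context {R : realType}.
Implicit Types (y z w : R) (p : int).

Lemma dist_int_le y p : dist_int y <= `|y - p%:~R|.
Proof.
apply: ge_inf; last by exists p.
by exists 0 => _ [q _ <-].
Qed.

Lemma dist_int_attained y :
  exists2 p, dist_int y = `|y - p%:~R| & `|y - p%:~R| <= 2^-1.
Proof.
pose p := Num.floor (y + 2^-1).
have /andP[p1 p2] : p%:~R <= y + 2^-1 < p%:~R + 1.
  by rewrite -[X in _ < _ + X]/(1%:~R) -intrD floor_le floorD1_gt.
have yp : `|y - p%:~R| <= 2^-1 by rewrite ler_norml; lra.
exists p => //; apply/eqP; rewrite eq_le dist_int_le/=.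
apply: lb_le_inf; first by exists `|y - p%:~R|; exists p.
move=> _ [q _ <-]; have [->//|qp] := eqVneq q p.
have : 1 <= `|(p - q)%:~R| :> R.
  by rewrite -intr_norm -[1]/(1%:~R) ler_int -gtz0_ge1 normr_gt0 subr_eq0 eq_sym.
have -> : (p - q)%:~R = (y - q%:~R) - (y - p%:~R) :> R by rewrite intrB; ring.
have := ler_normB (y - q%:~R) (y - p%:~R); lra.
Qed.

Lemma dist_int_ge0 y : 0 <= dist_int y.
Proof. by have [p -> _] := dist_int_attained y. Qed.

Lemma dist_int_le1 y : dist_int y <= 1.
Proof. by have [p -> yp] := dist_int_attained y; lra. Qed.

Lemma norm_sin_periodic w p : `|sin (w + pi * p%:~R)| = `|sin w|.
Proof.
have H (k : nat) (v : R) : `|sin (v + pi * k%:R)| = `|sin v|.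
  elim: k => [|k IH]; first by rewrite mulr0 addr0.
  by rewrite -natr1 mulrDr mulr1 addrA sinDpi normrN.
case: p => k; first exact: H.
by rewrite NegzE mulrNz mulrN -(H k.+1 (w - _)) subrK.
Qed.

Lemma norm_sin_dist_int_le y : `|sin (pi * y)| <= pi * dist_int y.
Proof.
have [p -> _] := dist_int_attained y.
have -> : pi * y = pi * (y - p%:~R) + pi * p%:~R by ring.
rewrite norm_sin_periodic; apply: le_trans (ler_norm_sin _) _.
by rewrite normrM ger0_norm// pi_ge0.
Qed.

Lemma sin_ge w : 0 <= w <= pi / 2 -> w / 4 <= sin w.
Proof.
move=> /andP[w0 wpi]; have w2 := pihalf_lt2 R; have pi2 := pi_ge2 R.
have s0 : 0 <= sin w by apply: sin_ge0_pi; lra.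
(* if [cos w <= 1/2] then [sin w >= 1/2 >= w / 4]; otherwise the mean value
   theorem gives [sin w >= w cos w >= w / 2] *)
have [c2|c2] := lerP (cos w) 2^-1.
  have c0 : 0 <= cos w by apply: cos_ge0_pihalf; lra.
  have := cos2Dsin2 w; nra.
have [z /andP[z0 zw]] := mean_value_ge0 w0 (@is_derive_sin R).
rewrite sin0 !subr0 => ->.
have : cos w <= cos z.
  by rewrite leNgt ltr_cos ?in_itv/= -?leNgt//; apply/andP; split; lra.
nra.
Qed.

Lemma norm_sin_dist_int_ge y : pi / 4 * dist_int y <= `|sin (pi * y)|.
Proof.
have [p -> y2] := dist_int_attained y.
have -> : pi * y = pi * (y - p%:~R) + pi * p%:~R by ring.
rewrite norm_sin_periodic; move: (y - _) y2 => z z2.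
have pi0 := pi_gt0 R.
rewrite mulrAC; have [z0|z0] := lerP 0 z.
  rewrite (ger0_norm z0) in z2 *.
  apply: le_trans (ler_norm _).
  by apply: sin_ge; rewrite mulr_ge0//= ?ler_pM2l// ltW.
rewrite (ltr0_norm z0) in z2 *.
rewrite -normrN -sinN -mulrN; apply: le_trans (ler_norm _).
by apply: sin_ge; rewrite mulr_ge0//= ?ler_pM2l//; lra.
Qed.

End DistInt.

Section DirichletKernel.
Context {R : realType}.
Implicit Types (a b y theta : R).

(** Closed form of a trigonometric sum along an arithmetic progression. *)
Lemma trig_sum_progression a b y theta (t : nat) :
  sin y * \sum_(0 <= k < t) trig a b (k%:R * (2 * y) + theta) =
  sin (t%:R * y) * trig a b (t%:R * y - y + theta).
Proof.
elim: t => [|t IH]; first by rewrite big_geq// mul0r sin0 mul0r mulr0.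
rewrite big_nat_recr//= mulrDr IH -[t.+1%:R]natr1.
set u := t%:R * y.
have -> : t%:R * (2 * y) + theta = (u + theta) + u by rewrite /u; ring.
have -> : (t%:R + 1) * y = u + y by rewrite /u; ring.
have -> : u - y + theta = (u + theta) - y by ring.
have -> : u + y - y + theta = u + theta by ring.
rewrite /trig !(cosD, sinD, cosN, sinN).
have := sin2cos2 u.
set su := sin u; set cu := cos u; set sy := sin y; set cy := cos y => Eu.
set st := sin theta; set ct := cos theta.
ring: Eu.
Qed.

Lemma trig_sum_progression_le a b y theta (t : nat) :
  `|\sum_(0 <= k < t) trig a b (k%:R * (2 * (pi * y)) + theta)| * dist_int y
    <= 4 * (`|a| + `|b|) * dist_int (t%:R * y).
Proof.
set S := \sum_(0 <= k < t) _.
have := congr1 Num.norm (trig_sum_progression a b (pi * y) theta t).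
rewrite -/S !normrM => E.
have pi0 := pi_gt0 R.
rewrite -(ler_pM2l (_ : 0 < pi / 4))//; last by lra.
apply: le_trans (_ : _ <= `|sin (pi * y)| * `|S|) _.
  by rewrite mulrCA mulrC ler_wpM2r// norm_sin_dist_int_ge.
rewrite E.
have -> : pi / 4 * (4 * (`|a| + `|b|) * dist_int (t%:R * y)) =
  (pi * dist_int (t%:R * y)) * (`|a| + `|b|) by field.
apply: ler_pM => //; last exact: ler_norm_trig.
by rewrite mulrCA norm_sin_dist_int_le.
Qed.

Lemma trig_sum_progression_triv a b y theta (t : nat) :
  `|\sum_(0 <= k < t) trig a b (k%:R * (2 * (pi * y)) + theta)|
    <= t%:R * (`|a| + `|b|).
Proof.
apply: le_trans (ler_norm_sum _ _ _) _.
apply: le_trans (_ : _ <= \sum_(0 <= k < t) (`|a| + `|b|)) _.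
  by apply: ler_sum => k _; exact: ler_norm_trig.
by rewrite big_const_nat iter_addr_0 subn0 mulr_natl.
Qed.

End DirichletKernel.

Section RealPart.
Context {R : realType} {n : nat}.

Lemma fourier_trig_series (c : 'rV[int]_n -> R[i]) (f : 'rV[R]_n -> R) :
  is_fourier_series c f ->
  is_trig_series (fun m => complex.Re (c m)) (fun m => complex.Im (c m)) f.
Proof.
move=> hf x; apply/cvgrPdist_lt => e e0.
have e0' : 0 < e%:C%C by rewrite ltcR.
have /cvgrPdist_lt /(_ _ e0') := hf x.
apply: filterS => A; set S := \sum_(_ <- _ | _) _ => H.
have ReS : complex.Re S = trig_sum (fun m => complex.Re (c m))
    (fun m => complex.Im (c m)) x A.
  rewrite /S /trig_sum (@big_morph _ _ (@complex.Re R) 0 +%R) //; last first.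
    by move=> [? ?] [? ?].
  by apply: eq_bigr => m _; case: (c m).
rewrite -ltcR; apply: le_lt_trans H; rewrite -ReS.
have -> : f x - complex.Re S = complex.Re ((f x)%:C%C - S) by case: (S).
exact: normc_ge_Re.
Qed.

Lemma norm_Re_le (z : R[i]) (r : R) : `|z| <= r%:C%C -> `|complex.Re z| <= r.
Proof. by move=> zr; rewrite -lecR; exact: le_trans (normc_ge_Re _) zr. Qed.

Lemma norm_Im_le (z : R[i]) (r : R) : `|z| <= r%:C%C -> `|complex.Im z| <= r.
Proof.
move=> zr; have -> : complex.Im z = - complex.Re (z * 'i)%C.
  by rewrite ReiNIm opprK.
rewrite normrN; apply: norm_Re_le.
suff -> : `|z * 'i%C| = `|z| by [].
by rewrite normrM [X in _ * X]normc_def/= expr0n expr1n add0r sqrtr1 mulr1.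
Qed.

End RealPart.

(** * Birkhoff sums of a trigonometric series *)

Section BirkhoffBound.
Context {R : realType} {n : nat}.
Implicit Types (m : 'rV[int]_n) (alpha x : 'rV[R]_n) (a b : 'rV[int]_n -> R).

Lemma dist_int_dotz alpha m (t : nat) (d : R) :
  (forall j, dist_int (t%:R * alpha 0 j) <= d) ->
  dist_int (t%:R * dotz m alpha) <= n%:R * d * (maxabs m)%:R.
Proof.
move=> td.
pose p j := s2val (cid2 (dist_int_attained (t%:R * alpha 0 j))).
have pd j : `|t%:R * alpha 0 j - (p j)%:~R| <= d.
  by rewrite /p; case: cid2 => q /= <-.
apply: le_trans (dist_int_le _ (\sum_j m 0 j * p j)) _.
rewrite rmorph_sum/= /dotz mulr_sumr -sumrB.
apply: le_trans (ler_norm_sum _ _ _) _.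
apply: le_trans (_ : _ <= \sum_(j < n) (maxabs m)%:R * d) _; last first.
  by rewrite sumr_const card_ord -[leLHS]mulr_natl mulrA mulrAC.
apply: ler_sum => j _.
have -> : t%:R * ((m 0 j)%:~R * alpha 0 j) - (m 0 j * p j)%:~R =
    (m 0 j)%:~R * (t%:R * alpha 0 j - (p j)%:~R) by rewrite intrM; ring.
by rewrite normrM; apply: ler_pM => //; exact: ler_norm_coord.
Qed.

Lemma birkhoff_sum_cvg a b f alpha x (t : nat) : is_trig_series a b f ->
  (fun A : {fset 'rV[int]_n} => \sum_(m <- A | m != 0)
    \sum_(0 <= k < t) trig (a m) (b m)
       (k%:R * (2 * (pi * dotz m alpha)) + 2 * pi * dotz m x)) @ totally
  --> birkhoff_sum f t alpha x.
Proof.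
move=> ser; rewrite (_ : (fun _ => _) = fun A : {fset 'rV[int]_n} =>
  \sum_(0 <= k < t) trig_sum a b (k%:R *: alpha + x) A).
  rewrite /birkhoff_sum; elim: t => [|t IH].
    rewrite big_geq//; under eq_fun do rewrite big_geq//.
    exact: cvg_cst.
  rewrite big_nat_recr//=; under eq_fun do rewrite big_nat_recr//=.
  by apply: cvgD; [exact: IH|exact: ser].
apply/funext => A; rewrite exchange_big/=; apply: eq_bigr => k _.
apply: eq_bigr => m _; congr trig; rewrite dotzD dotzZ; ring.
Qed.

(** Low frequencies [|m| <= M] are controlled by the quality [d] of [t] as a
    simultaneous approximation and by the lower bound [r] for the small
    divisors; high frequencies by the decay of the coefficients. *)
Lemma birkhoff_sum_le (s v : R) a b f alpha : (0 < n)%N ->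
  n%:R + 1 < s -> 0 <= v -> n%:R + v < s -> decay s a -> decay s b ->
  is_trig_series a b f ->
  exists2 K : R, 0 <= K & forall (t : nat) (M d r : R) x, 0 < M -> 0 < r ->
    (forall j, dist_int (t%:R * alpha 0 j) <= d) ->
    (forall m, m != 0 -> (maxabs m)%:R <= M -> r <= dist_int (dotz m alpha)) ->
    `|birkhoff_sum f t alpha x| <= K * (d / r + t%:R * M `^ (- v)).
Proof.
move=> n0 ns v0 nv da db ser.
have [K1 K10 HK1] := decay_sum n0 ns da.
have [K2 K20 HK2] := decay_sum n0 ns db.
have [K3 K30 HK3] := decay_sum n0 nv da.
have [K4 K40 HK4] := decay_sum n0 nv db.
pose L := 4 * n%:R * (K1 + K2) + (K3 + K4).
have L0 : 0 <= 4 * n%:R * (K1 + K2) by rewrite !mulr_ge0// addr_ge0.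
exists L; first by rewrite /L; lra.
move=> t M d r x M0 r0 td rm.
have d0 : 0 <= d.
  by apply: le_trans (td (Ordinal n0)); exact: dist_int_ge0.
have dr0 : 0 <= d / r by rewrite divr_ge0// ltW.
have tM0 : 0 <= t%:R * M `^ (- v) by rewrite mulr_ge0// powR_ge0.
apply: (totally_lim_le _ (birkhoff_sum_cvg ser)) => A.
apply: le_trans (ler_norm_sum _ _ _) _.
pose S1 := \sum_(m <- A | m != 0)
  (`|a m| * (maxabs m)%:R `^ 1 + `|b m| * (maxabs m)%:R `^ 1).
pose S2 := \sum_(m <- A | m != 0)
  (`|a m| * (maxabs m)%:R `^ v + `|b m| * (maxabs m)%:R `^ v).
have S1K : S1 <= K1 + K2 by rewrite /S1 big_split/=; exact: lerD.
have S2K : S2 <= K3 + K4 by rewrite /S2 big_split/=; exact: lerD.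
apply: le_trans (_ : _ <= 4 * n%:R * (d / r) * S1 + t%:R * M `^ (- v) * S2) _.
  rewrite /S1 /S2 !mulr_sumr -big_split/=; apply: ler_sum => m m0.
  set ab := `|a m| + `|b m|.
  rewrite -!mulrDl -/ab.
  have ab0 : 0 <= ab by rewrite addr_ge0.
  have [mM|mM] := lerP (maxabs m)%:R M.
    rewrite ler_wpDr//; first by rewrite !mulr_ge0// powR_ge0.
    have rd := rm m m0 mM.
    have rd0 := lt_le_trans r0 rd.
    set th := 2 * pi * _.
    have := trig_sum_progression_le (a m) (b m) (dotz m alpha) th t.
    rewrite -ler_pdivlMr// => /le_trans; apply.
    rewrite powRr1// ler_pdivrMr// -/ab.
    apply: le_trans (_ : _ <= 4 * n%:R * (d / r) * (ab * (maxabs m)%:R) * r) _.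
      have -> : 4 * n%:R * (d / r) * (ab * (maxabs m)%:R) * r =
        4 * ab * (n%:R * d * (maxabs m)%:R) by field; rewrite gt_eqF.
      by rewrite ler_wpM2l ?mulr_ge0// dist_int_dotz.
    by rewrite ler_wpM2l// mulr_ge0// mulr_ge0// mulr_ge0.
  rewrite ler_wpDl//; first by do !apply: mulr_ge0 => //.
  apply: le_trans (trig_sum_progression_triv _ _ _ _ _) _.
  rewrite -mulrA ler_wpM2l// -/ab mulrCA ler_peMr//.
  rewrite powRN mulrC ler_pdivlMr ?powR_gt0// mul1r.
  by apply: ge0_ler_powR; rewrite ?nnegrE// ltW.
rewrite /L mulrDl mulrDr.
have H1 : 4 * n%:R * (d / r) * S1 <= 4 * n%:R * (d / r) * (K1 + K2).
  by rewrite ler_wpM2l// mulr_ge0// mulr_ge0.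
have H2 : t%:R * M `^ (- v) * S2 <= t%:R * M `^ (- v) * (K3 + K4).
  by rewrite ler_wpM2l.
have H3 : 0 <= 4 * n%:R * (K1 + K2) * (t%:R * M `^ (- v)) by rewrite mulr_ge0.
have H4 : 0 <= (K3 + K4) * (d / r) by rewrite mulr_ge0// addr_ge0.
lra.
Qed.

End BirkhoffBound.

(** * The uniform exponents *)

Section LimsupAtInfinity.
Context {R : realType}.
Implicit Types (u : R -> R).

Lemma limf_esup_pinfty_lty u (B T : R) : (forall t, T < t -> u t <= B) ->
  (limf_esup (fun t => (u t)%:E) (pinfty_nbhs R) < +oo)%E.
Proof.
move=> uB; apply: (@le_lt_trans _ _ B%:E); last exact: ltry.
apply: (@le_trans _ _ (ereal_sup ((fun t => (u t)%:E) @` [set t | T < t]))).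
  apply: ereal_inf_lbound; exists [set t | T < t] => //.
  by exists T; split=> //; exact: num_real.
by apply: ge_ereal_sup => _ [t Tt <-]; rewrite lee_fin uB.
Qed.

Lemma limf_esup_pinfty_bounded u :
  (limf_esup (fun t => (u t)%:E) (pinfty_nbhs R) < +oo)%E ->
  exists B T : R, forall t, T < t -> u t <= B.
Proof.
move=> /ereal_inf_lt[_ [V [T [_ TV]] <-] supV].
have [B HB] : exists B : R, (ereal_sup ((fun t => (u t)%:E) @` V) <= B%:E)%E.
  move: supV; case: (ereal_sup _) => [B _| //|_]; first by exists B.
  by exists 0; rewrite leNye.
exists B, T => t Tt; rewrite -lee_fin; apply: le_trans HB.
by apply: ereal_sup_ubound; exists t => //; exact: TV.
Qed.

End LimsupAtInfinity.

Section Exponents.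
Context {R : realType} {n : nat}.
Implicit Types (m : 'rV[int]_n) (alpha : 'rV[R]_n) (t : R).

Lemma psi_le alpha m t : m != 0 -> (maxabs m)%:R <= t ->
  psi alpha t <= dist_int (dotz m alpha).
Proof.
move=> m0 mt; apply: ge_inf; last by exists m => //; split=> //; exact: maxabs_gt0.
by exists 0 => _ [q _ <-]; exact: dist_int_ge0.
Qed.

Lemma psi_star_ge0 alpha t : 0 <= psi_star alpha t.
Proof.
rewrite /psi_star; set S := (X in inf X).
have [->|/set0P S0] := eqVneq S set0; first by rewrite inf0.
by apply: lb_le_inf => // _ [q _ <-]; apply/bigmax_geP; left.
Qed.

Lemma psi_star_approx alpha t e : 1 <= t -> 0 < e ->
  exists q : nat, [/\ (0 < q)%N, q%:R <= t &
    forall j, dist_int (q%:R * alpha 0 j) <= psi_star alpha t + e].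
Proof.
move=> t1 e0.
have [|_ [q [q1 qt] <-] qe] := @inf_adherent _ [set
    \big[Num.max/0]_(j < n) dist_int (q%:~R * alpha 0 j) |
    q in [set q : int | 1 <= q /\ q%:~R <= t]] e e0.
  split; first by eexists; exists 1.
  by exists 0 => _ [q _ <-]; apply/bigmax_geP; left.
case: q q1 qt qe => // q q1 qt qe.
exists q; split=> // j; apply: le_trans (ltW qe).
by apply/bigmax_geP; right; exists j.
Qed.

Lemma psi_star_le alpha t (q : nat) (d : R) : (0 < q)%N -> q%:R <= t ->
  0 <= d -> (forall j, dist_int (q%:R * alpha 0 j) <= d) ->
  psi_star alpha t <= d.
Proof.
move=> q0 qt d0 qd.
apply: (@le_trans _ _ (\big[Num.max/0]_(j < n) dist_int (q%:R * alpha 0 j))).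
  apply: ge_inf; last by exists q%:Z => //; split=> //; rewrite lez_nat.
  by exists 0 => _ [p _ <-]; apply/bigmax_geP; left.
by apply/bigmax_leP; split.
Qed.

(** Beyond the uniform exponent, good lower bounds for the small divisors hold
    along an unbounded set of heights. *)
Lemma omega_hat_lt alpha (g T : R) : (omega_hat alpha < g%:E)%E ->
  exists2 t, T < t & 1 <= t `^ g * psi alpha t.
Proof.
move=> og; apply: contrapT => H.
suff : (g%:E <= omega_hat alpha)%E by rewrite leNgt og.
apply: ereal_sup_ubound; exists g => //=.
apply: (@limf_esup_pinfty_lty _ _ 1 T) => t Tt.
by rewrite leNgt; apply/negP => /ltW t1; apply: H; exists t.
Qed.

(** Below the uniform exponent, good simultaneous approximations exist at every
    large height. *)
Lemma lambda_hat_gt alpha (l : R) : (l%:E < lambda_hat alpha)%E ->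
  exists B T : R, forall t, T < t -> t `^ l * psi_star alpha t <= B.
Proof.
move=> /ereal_sup_gt[_ [l' /= Hl' <-]]; rewrite lte_fin => ll'.
have [B [T HT]] := limf_esup_pinfty_bounded Hl'.
exists B, (Num.max T 1) => t; rewrite gt_max => /andP[Tt t1].
apply: le_trans (HT t Tt); rewrite ler_wpM2r ?psi_star_ge0//.
by apply: ler_powR; exact: ltW.
Qed.

Lemma lambda_hat_ge0 alpha : (0 <= lambda_hat alpha)%E.
Proof.
apply: ereal_sup_ubound; exists 0 => //=.
apply: (@limf_esup_pinfty_lty _ _ 1 1) => t t1; rewrite powRr0 mul1r.
apply: (@psi_star_le _ _ 1%N) => //; first exact: ltW.
by move=> j; exact: dist_int_le1.
Qed.

(** Dirichlet's theorem in dimension one, by the pigeonhole principle on the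
    fractional parts of [0, y, ..., N y]. *)
Lemma dirichlet1 (y : R) (N : nat) : (0 < N)%N ->
  exists q : nat, [/\ (0 < q)%N, (q <= N)%N & dist_int (q%:R * y) <= N%:R^-1].
Proof.
move=> N0; have N0' : 0 < N%:R :> R by rewrite ltr0n.
pose fl (k : nat) := Num.floor (k%:R * y).
pose fr (k : nat) : R := k%:R * y - (fl k)%:~R.
have fr01 k : 0 <= fr k < 1.
  rewrite /fr subr_ge0 floor_le ltrBlDl addrC /fl.
  by rewrite -[X in _ < X + _]/(1%:~R) addrC -intrD floorD1_gt.
have box0 k : 0 <= N%:R * fr k by rewrite mulr_ge0//; case/andP: (fr01 k).
have boxN k : (Num.truncn (N%:R * fr k) < N)%N.
  by rewrite truncn_lt_nat// gtr_pMr//; case/andP: (fr01 k).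
pose box (k : 'I_N.+1) : 'I_N := Ordinal (boxN k).
have cl (i j : 'I_N.+1) : (i < j)%N -> box i = box j ->
    exists q : nat, [/\ (0 < q)%N, (q <= N)%N & dist_int (q%:R * y) <= N%:R^-1].
  move=> ij /(congr1 val) /= bij; exists (j - i)%N.
  split; [by rewrite subn_gt0|by rewrite (leq_trans (leq_subr _ _))// -ltnS|].
  apply: le_trans (dist_int_le _ (fl j - fl i)) _.
  have -> : (j - i)%:R * y - (fl j - fl i)%:~R = fr j - fr i.
    by rewrite /fr natrB 1?ltnW// intrB; ring.
  rewrite -(ler_pM2l N0') divff ?gt_eqF// -[X in X * _](ger0_norm (ltW N0')).
  rewrite -normrM mulrBr.
  have := truncn_itv (box0 i); have := truncn_itv (box0 j).
  rewrite bij -natr1 => /andP[? ?] /andP[? ?].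
  by rewrite ler_norml; lra.
have /injectivePn[i [j ij bij]] : ~~ injectiveb box.
  by apply/negP => /injectiveP/leq_card; rewrite !card_ord ltnn.
have [ltij|ltji|/val_inj eij] := ltngtP i j.
- exact: cl bij.
- exact: cl (esym bij).
- by rewrite eij eqxx in ij.
Qed.

Lemma omega_hat_ge1 alpha : (0 < n)%N -> (1 <= omega_hat alpha)%E.
Proof.
move=> n0; apply: ereal_sup_ubound; exists 1 => //=.
apply: (@limf_esup_pinfty_lty _ _ 2 1) => t t1.
pose N := `|Num.floor t|%N.
have t0 : 0 <= t by lra.
have NE : N%:R = (Num.floor t)%:~R :> R.
  by rewrite /N natr_absz ger0_norm// floor_ge0.
have Nt : N%:R <= t by rewrite NE floor_le.
have tN : t < N%:R + 1 by rewrite NE -[X in _ + X]/(1%:~R) -intrD floorD1_gt.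
have N0 : (0 < N)%N by rewrite lt0n; apply/eqP => N0; move: tN; rewrite N0; lra.
have [q [q0 qN qy]] := dirichlet1 (alpha 0 (Ordinal n0)) N0.
(* a frequency supported on the first coordinate *)
pose m : 'rV[int]_n := \row_j (if j == Ordinal n0 then q%:Z else 0).
have mq : dotz m alpha = q%:R * alpha 0 (Ordinal n0).
  rewrite /dotz (bigD1 (Ordinal n0))//= mxE eqxx big1 ?addr0// => j jn.
  by rewrite mxE (negPf jn) mul0r.
have m0 : m != 0.
  apply/eqP => /rowP /(_ (Ordinal n0)); rewrite !mxE eqxx => -[]; lia.
have mN : (maxabs m <= N)%N.
  by apply/bigmax_leqP => j _; rewrite mxE; case: ifP.
have mt : (maxabs m)%:R <= t by apply: le_trans Nt; rewrite ler_nat.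
have := psi_le alpha m0 mt; rewrite mq => /le_trans /(_ qy) H.
rewrite powRr1//; apply: le_trans (ler_wpM2l t0 H) _.
have N1 : 1 <= N%:R :> R by rewrite ler1n.
by rewrite ler_pdivrMr; lra.
Qed.

Lemma irrational_coord alpha j (q : nat) (p : int) :
  completely_irrational alpha -> (0 < q)%N -> q%:R * alpha 0 j != p%:~R.
Proof.
move=> irr q0; apply/eqP => E.
have [|_] := irr (- p%:~R) (\row_i (if i == j then q%:R else 0)).
  rewrite mulr1 (bigD1 j)//= mxE eqxx big1 ?addr0; last first.
    by move=> i ij; rewrite mxE (negPf ij) rmorph0 mul0r.
  by rewrite rmorphN/= ratr_int ratr_nat E addNr.
move=> /rowP /(_ j); rewrite !mxE eqxx => /eqP.
by rewrite pnatr_eq0 -leqn0 leqNgt q0.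
Qed.

Lemma dist_int_irrational_gt0 alpha j (q : nat) :
  completely_irrational alpha -> (0 < q)%N -> 0 < dist_int (q%:R * alpha 0 j).
Proof.
move=> irr q0; have [p -> _] := dist_int_attained (q%:R * alpha 0 j).
by rewrite normr_gt0 subr_eq0 irrational_coord.
Qed.

(** Two rational approximations [p / q] and [p' / q'] of [y] at consecutive
    heights are equal once [q p' - q' p], an integer, is less than [1] in
    absolute value; they are then all equal to one fraction, and to [y]. *)
Lemma uniform_approx_rational (y : R) (d : nat -> R) (N1 : nat) :
  (forall N, (N1 <= N)%N -> N.+1%:R * d N < 2^-1) ->
  (forall e : R, 0 < e -> exists2 N, (N1 <= N)%N & d N < e) ->
  (forall N, (N1 <= N)%N -> exists q : nat,
     [/\ (0 < q)%N, (q <= N)%N & dist_int (q%:R * y) <= d N]) ->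
  exists (q : nat) (p : int), (0 < q)%N /\ q%:R * y = p%:~R.
Proof.
move=> dsmall dlim approx.
have approx' N : (N1 <= N)%N -> exists (q : nat) (p : int),
    [/\ (0 < q)%N, (q <= N)%N & `|q%:R * y - p%:~R| <= d N].
  move=> /approx[q [q0 qN]]; have [p -> _] := dist_int_attained (q%:R * y).
  by exists q, p.
have [q0 [p0 [q00 q0N pq0]]] := approx' N1 (leqnn N1).
have same N : (N1 <= N)%N -> exists (q : nat) (p : int),
    [/\ (0 < q)%N, (q <= N)%N, `|q%:R * y - p%:~R| <= d N &
        p * q0%:Z = p0 * q%:Z].
  elim: N => [|N IH].
    rewrite leqn0 => /eqP N10; rewrite N10 in q0N.
    by move: (leq_trans q00 q0N).
  rewrite leq_eqVlt => /predU1P[<-|]; first by exists q0, p0.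
  rewrite ltnS => N1N.
  have [q [p [q_gt0 qN pq eq0]]] := IH N1N.
  have [q' [p' [q'_gt0 q'N pq']]] := approx' N.+1 (leqW N1N).
  exists q', p'; split=> //.
  suff E : p' * q%:Z = p * q'%:Z.
    have qn0 : q%:Z != 0 by rewrite eqz_nat -lt0n.
    apply: (mulIf qn0); rewrite mulrAC E mulrAC eq0; ring.
  apply/eqP; rewrite -subr_eq0; apply: contraT => E0.
  have : 1 <= `|(p' * q%:Z - p * q'%:Z)%:~R| :> R.
    by rewrite -intr_norm -[1]/(1%:~R) ler_int -gtz0_ge1 normr_gt0.
  have -> : (p' * q%:Z - p * q'%:Z)%:~R =
      q'%:R * (q%:R * y - p%:~R) - q%:R * (q'%:R * y - p'%:~R) :> R.
    by rewrite intrB !intrM -!pmulrn; ring.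
  have H1 : `|q'%:R * (q%:R * y - p%:~R)| <= N.+1%:R * d N.
    by rewrite normrM ger0_norm//; apply: ler_pM => //; rewrite ler_nat.
  have H2 : `|q%:R * (q'%:R * y - p'%:~R)| <= N.+2%:R * d N.+1.
    by rewrite normrM ger0_norm//; apply: ler_pM => //; rewrite ler_nat !leqW.
  have := ler_normB (q'%:R * (q%:R * y - p%:~R)) (q%:R * (q'%:R * y - p'%:~R)).
  have := dsmall N N1N; have := dsmall N.+1 (leqW N1N); lra.
exists q0, p0; split=> //; apply/eqP; rewrite -subr_eq0 -normr_eq0.
apply: contraT => z0; set z := `|_| in z0.
have zp : 0 < z by rewrite lt_neqAle eq_sym z0 normr_ge0.
have q0p : 0 < q0%:R :> R by rewrite ltr0n.
have [N N1N dN] := dlim (z / q0%:R) (divr_gt0 zp q0p).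
have [q [p [q_gt0 qN pq eq0]]] := same N N1N.
have E : q0%:R * (q%:R * y - p%:~R) = q%:R * (q0%:R * y - p0%:~R).
  have := congr1 (fun k : int => k%:~R : R) eq0; rewrite !intrM -!pmulrn => Er.
  by rewrite !mulrBr; ring: Er.
have := congr1 Num.norm E; rewrite !normrM !(ger0_norm (ler0n _ _)) -/z => Ez.
have q1 : 1 <= q%:R :> R by rewrite ler1n.
have : z <= q0%:R * d N by apply: le_trans (ler_wpM2l (ltW q0p) pq); rewrite Ez; nra.
by rewrite leNgt mulrC -ltr_pdivlMr// dN.
Qed.

Lemma powR_lim_pinfty (K c e : R) : 0 <= K -> 0 < c -> 0 < e ->
  exists2 T : R, 0 < T & forall t, T < t -> K * t `^ (- c) < e.
Proof.
move=> K0 c0 e0; have [d d0 Hd] := powR_lim0 K0 c0 e0.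
exists d^-1; first by rewrite invr_gt0.
move=> t dt; have t0 : 0 < t by apply: lt_trans dt; rewrite invr_gt0.
have -> : t `^ (- c) = t^-1 `^ c.
  by rewrite -powR_inv1 ?ltW// -powRrM mulN1r.
by apply: Hd; rewrite invr_ge0 ltW//= invf_plt ?posrE.
Qed.

(** A uniform exponent above [1] would make each coordinate rational. *)
Lemma lambda_hat_le1 alpha : (0 < n)%N -> completely_irrational alpha ->
  (lambda_hat alpha <= 1)%E.
Proof.
move=> n0 irr; pose j0 := Ordinal n0; rewrite leNgt; apply/negP.
move=> /ereal_sup_gt[_ [l /= Hl <-]]; rewrite lte_fin => l1.
have [B [T HT]] := limf_esup_pinfty_bounded Hl.
pose D := `|B| + 1; have D0 : 0 <= D by rewrite addr_ge0.
pose d (N : nat) := D * N%:R `^ (- l).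
have l1' : 0 < l - 1 by lra.
have h0 : 0 < 2^-1 :> R by lra.
have [T1 T10 HT1] := powR_lim_pinfty (mulr_ge0 (ler0n R 2) D0) l1' h0.
(* beyond [N1], both [HT] and [HT1] apply *)
have [N1 [N1T N1T1 N10]] : exists N1 : nat, [/\ T < N1%:R, T1 < N1%:R & (0 < N1)%N].
  exists (Num.truncn (Num.max T T1)).+1.
  by have := truncnS_gt (Num.max T T1); rewrite gt_max => /andP[].
have geN1 (N : nat) : (N1 <= N)%N -> [/\ T < N%:R, T1 < N%:R & 1 <= N%:R :> R].
  move=> N1N; have ? : N1%:R <= N%:R :> R by rewrite ler_nat.
  split; [lra|lra|by rewrite ler1n (leq_trans N10)].
have [||N /geN1[NT NT1 N1']|q [p [q0 E]]] :=
    @uniform_approx_rational (alpha 0 j0) d N1.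
- move=> N /geN1[_ NT1 N1']; apply: le_lt_trans (HT1 _ NT1).
  have Np : 0 < N%:R :> R by lra.
  rewrite opprB powRD; last by rewrite (gt_eqF Np) implybT.
  rewrite powRr1 ?(ltW Np)//.
  rewrite -natr1 /d; have := powR_ge0 (N%:R : R) (- l) => P.
  have DP := mulr_ge0 D0 P; nra.
- move=> e e0.
  have [T2 T20 HT2] := powR_lim_pinfty D0 (lt_trans ltr01 l1) e0.
  exists (maxn N1 (Num.truncn T2).+1); first exact: leq_maxl.
  apply: HT2; apply: lt_le_trans (truncnS_gt T2) _.
  by rewrite ler_nat leq_maxr.
- have e0 : 0 < N%:R `^ (- l) :> R by rewrite powR_gt0//; lra.
  have [q [q0 qN qd]] := psi_star_approx alpha N1' e0.
  exists q; split=> //; first by rewrite -(ler_nat R).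
  apply: le_trans (qd j0) _; rewrite /d mulrDl mul1r lerD2r.
  rewrite powRN ler_pdivlMr ?powR_gt0//; last by lra.
  by rewrite mulrC; apply: le_trans (HT _ NT) (ler_norm _).
by have := irrational_coord j0 p irr q0; rewrite E eqxx.
Qed.

Lemma dist_int_lower_bound alpha (N : nat) : (0 < n)%N ->
  completely_irrational alpha ->
  exists2 e : R, 0 < e & forall q : nat, (0 < q < N)%N ->
    exists j, e <= dist_int (q%:R * alpha 0 j).
Proof.
move=> n0 irr; pose j0 := Ordinal n0.
elim: N => [|N [e e0 He]]; first by exists 1 => // q; rewrite ltn0 andbF.
have [->|N0] := posnP N; first by exists 1 => // -[].
exists (Num.min e (dist_int (N%:R * alpha 0 j0))).
  by rewrite lt_min e0 dist_int_irrational_gt0.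
move=> q /andP[q0]; rewrite ltnS leq_eqVlt => /predU1P[->|qN].
  by exists j0; rewrite ge_min lexx orbT.
have [|j ej] := He q; first by rewrite q0.
by exists j; rewrite ge_min ej.
Qed.

End Exponents.

(** * Conclusion *)

Section Conclusion.
Context {R : realType} {n : nat}.
Implicit Types (alpha : 'rV[R]_n).

(** With the conventions [x / 0 = +oo] and [+oo / x = +oo] for [0 < x], the
    hypothesis on [gamma] forces both exponents to be real. *)
Lemma exponents_fin alpha (gamma : R) : (0 < n)%N ->
  completely_irrational alpha ->
  (n%:R%:E + omega_hat alpha / lambda_hat alpha < gamma%:E)%E ->
  exists w l : R, [/\ omega_hat alpha = w%:E, lambda_hat alpha = l%:E,
    1 <= w, 0 < l <= 1 & n%:R + w / l < gamma].
Proof.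
move=> n0 irr.
have := omega_hat_ge1 alpha n0; have := lambda_hat_ge0 alpha.
have := lambda_hat_le1 n0 irr.
case: (lambda_hat alpha) => [l||]//; rewrite !lee_fin => l1 l0.
have [->|ln0] := eqVneq l 0.
  rewrite inve0; case: (omega_hat alpha) => [w||]//.
  by rewrite lee_fin => w1; rewrite gt0_muley// lte_fin; lra.
have lp : 0 < l by rewrite lt_neqAle eq_sym ln0.
rewrite inver (negPf ln0); case: (omega_hat alpha) => [w||]//.
  rewrite lee_fin => w1; rewrite -EFinM -EFinD lte_fin => H.
  by exists w, l; rewrite lp l1.
by rewrite gt0_mulye// lte_fin invr_gt0.
Qed.

Lemma limn_einf_eq0 (u : nat -> \bar R) : (forall t, 0 <= u t)%E ->
  (forall (e : R) (N : nat), 0 < e -> exists2 t, (N <= t)%N & (u t <= e%:E)%E) ->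
  limn_einf u = 0%E.
Proof.
move=> u0 ue; rewrite limn_einf_lim; apply/eqP; rewrite eq_le; apply/andP; split.
  apply/lee_addgt0Pr => e e0; rewrite add0e; apply: lime_le.
    exact: is_cvg_einfs.
  apply: nearW => N; have [t Nt ut] := ue e N e0.
  by apply: le_trans ut; apply: ereal_inf_lbound; exists t.
apply: lime_ge; first exact: is_cvg_einfs.
by apply: nearW => N; apply: le_ereal_inf_tmp => _ [t _ <-].
Qed.

Lemma sup_birkhoff_ge0 (f : 'rV[R]_n -> R) t alpha :
  (0 <= sup_birkhoff f t alpha)%E.
Proof.
apply: (@le_trans _ _ (`|birkhoff_sum f t alpha 0|)%:E).
  by rewrite lee_fin.
by apply: ereal_sup_ubound; exists 0.
Qed.

(** Heights [M] with good lower bounds for the small divisors are matched with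
    a simultaneous approximation [t <= M ^ h]; the low frequencies contribute
    [O(M ^ (g - l h))] and the high ones [O(M ^ (h - v))].  The integer [N] is
    an arbitrary lower bound for [t]. *)
Lemma small_birkhoff_sums alpha (s g l h v : R) a b f (e : R) (N : nat) :
  (0 < n)%N -> completely_irrational alpha ->
  n%:R + 1 < s -> 0 <= v -> n%:R + v < s ->
  decay s a -> decay s b -> is_trig_series a b f ->
  (omega_hat alpha < g%:E)%E -> (l%:E < lambda_hat alpha)%E ->
  0 < l -> 0 < h -> g < l * h -> h < v -> 0 < e ->
  exists2 t : nat, (N <= t)%N & forall x, `|birkhoff_sum f t alpha x| <= e.
Proof.
move=> n0 irr ns v0 nv da db ser og ll l0 h0 glh hv e0.
have [K K0 HK] := birkhoff_sum_le alpha n0 ns v0 nv da db ser.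
have [B [T HT]] := lambda_hat_gt ll.
have [e1 e10 He1] := dist_int_lower_bound N n0 irr.
pose D := `|B| + 1; have D0 : 0 <= D by rewrite addr_ge0.
have lh0 : 0 < l * h by rewrite mulr_gt0.
have c1 : 0 < l * h - g by lra.
have c2 : 0 < v - h by lra.
have e20 : 0 < e / 2 by lra.
have [T1 T10 HT1] := powR_lim_pinfty D0 lh0 e10.
have [T2 T20 HT2] := powR_lim_pinfty (mulr_ge0 K0 D0) c1 e20.
have [T3 T30 HT3] := powR_lim_pinfty K0 c2 e20.
(* [M > T4] ensures that [M ^ h] exceeds both [1] and [T] *)
pose T4 := Num.max 1 T `^ h^-1.
have [M] := omega_hat_lt (Num.max (Num.max T1 T2) (Num.max T3 (Num.max T4 1))) og.
rewrite !gt_max => /andP[/andP[T1M T2M] /and3P[T3M T4M M1]] psiM.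
have M0 : 0 < M by lra.
pose Q := M `^ h.
have Q0 : 0 < Q by rewrite powR_gt0.
have maxT0 : 0 <= Num.max 1 T :> R by rewrite le_max ler01.
have QT : Num.max 1 T < Q.
  have -> : Num.max 1 T = T4 `^ h.
    by rewrite /T4 -powRrM mulVf ?gt_eqF// powRr1.
  by rewrite gt0_ltr_powR ?nnegrE ?powR_ge0// ltW.
move: QT; rewrite gt_max => /andP[Q1 TQ].
have [t [t0 tQ td]] := psi_star_approx alpha (ltW Q1) (powR_gt0 (- l) Q0).
have {}td j : dist_int (t%:R * alpha 0 j) <= D * Q `^ (- l).
  apply: le_trans (td j) _; rewrite /D mulrDl mul1r lerD2r.
  rewrite powRN ler_pdivlMr ?powR_gt0// mulrC.
  by apply: le_trans (HT _ TQ) (ler_norm _).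
have Ql : Q `^ (- l) = M `^ (- (l * h)).
  by rewrite /Q -powRrM; congr (_ `^ _); ring.
exists t.
  rewrite leqNgt; apply/negP => tN.
  have [|j] := He1 t; first by rewrite t0.
  by apply/negP; rewrite -ltNge; apply: le_lt_trans (td j) _; rewrite Ql HT1.
move=> x.
have r0 : 0 < M `^ (- g) by rewrite powR_gt0.
have rm (m : 'rV[int]_n) : m != 0 -> (maxabs m)%:R <= M ->
    M `^ (- g) <= dist_int (dotz m alpha).
  move=> m0 mM; apply: le_trans (psi_le alpha m0 mM).
  by rewrite powRN -div1r ler_pdivrMr ?powR_gt0// mulrC.
apply: le_trans (HK t M _ _ x M0 r0 td rm) _.
have E1 : K * (D * Q `^ (- l) / M `^ (- g)) = K * D * M `^ (- (l * h - g)).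
  rewrite Ql -mulrA -powRB; last by rewrite (gt_eqF M0) implybT.
  by rewrite mulrA; congr (_ * (_ `^ _)); ring.
have E2 : K * (t%:R * M `^ (- v)) <= K * M `^ (- (v - h)).
  rewrite ler_wpM2l// opprB addrC powRD; last by rewrite (gt_eqF M0) implybT.
  by rewrite mulrC ler_wpM2l ?powR_ge0.
rewrite mulrDr E1; have := HT2 M T2M; have := HT3 M T3M; lra.
Qed.

End Conclusion.

Theorem theorem5 (R : realType) (n : nat) (hn : (2 <= n)%N)
    (alpha : 'rV[R]_n) (halpha : completely_irrational alpha)
    (gamma : R)
    (hgamma : (n%:R%:E + omega_hat alpha / lambda_hat alpha < gamma%:E)%E)
    (f : 'rV[R]_n -> R) (c : 'rV[int]_n -> R[i])
    (hf : is_fourier_series c f)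
    (C : R) (hC : 0 < C)
    (hc : forall m : 'rV[int]_n, m != 0 ->
       `|c m| <= (C * (maxabs m)%:R `^ (- gamma))%:C%C) :
  (forall w : nat, w%:R < gamma - n%:R -> smooth w f) /\
  limn_einf (fun t : nat => sup_birkhoff f t alpha) = 0%E.
Proof.
have n0 : (0 < n)%N by apply: leq_trans hn.
have ser := fourier_trig_series hf.
have da : decay gamma (fun m => complex.Re (c m)).
  by exists C; [exact: ltW|move=> m m0; apply: norm_Re_le; exact: hc].
have db : decay gamma (fun m => complex.Im (c m)).
  by exists C; [exact: ltW|move=> m m0; apply: norm_Im_le; exact: hc].
split.
  by move=> w wn; apply: (trig_series_smooth n0 _ da db ser); lra.
have [w [l [oE lE w1 /andP[l0 l1] wl]]] := exponents_fin n0 halpha hgamma.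
have wl1 : 1 <= w / l by rewrite ler_pdivlMr//; lra.
(* [w / l < h < v < gamma - n], so that [w < l * h]; [eta] is small enough for
   [w + eta < (l - eta) * h] *)
pose kappa := gamma - n%:R - w / l.
have kappa0 : 0 < kappa by rewrite /kappa; lra.
pose v := w / l + kappa * (3 / 4).
pose h := w / l + kappa / 2.
have h0 : 0 < h by rewrite /h; lra.
pose eta := l * kappa / (4 * (1 + h)).
have h1 : 0 < 1 + h by lra.
have eta0 : 0 < eta by rewrite /eta divr_gt0// mulr_gt0.
have etaE : eta * (1 + h) = l * kappa / 4 by rewrite /eta; field; rewrite gt_eqF.
have lh : l * h = w + l * kappa / 2 by rewrite /h; field; rewrite gt_eqF.
have lk : 0 < l * kappa by rewrite mulr_gt0.
have etal : eta < l.
  rewrite /eta ltr_pdivrMr ?mulr_gt0//.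
  by rewrite ltr_pM2l// /h; lra.
apply: limn_einf_eq0 => [t|e N e0]; first exact: sup_birkhoff_ge0.
have [||||||||||t Nt St] := @small_birkhoff_sums _ _ alpha gamma (w + eta)
  (l - eta) h v _ _ f e N n0 halpha _ _ _ da db ser.
- by rewrite /kappa in kappa0; lra.
- by rewrite /v; lra.
- by rewrite /v /kappa; rewrite /kappa in kappa0; lra.
- by rewrite oE lte_fin ltrDl.
- by rewrite lE lte_fin ltrBlDr ltrDl.
- by rewrite subr_gt0.
- by [].
- by rewrite mulrBl lh; lra.
- by rewrite /h /v; lra.
- by [].
exists t => //; apply: ge_ereal_sup => _ [x _ <-].
by rewrite lee_fin.
Qed.
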